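(* Let $(M^n,g)$ be a connected complete finite-dimensional Riemannian manifold, let $\mathcal X\subset M^n$ be a subset with the metric induced by the metric generated by $g$, let $\Theta$ be a Souslin space and let $(\Theta,\mu_\Theta,\mathbf p,\mathcal X)$ be a Bayesian statistical model, with $p_\theta:=\mathbf p(\theta)$ and marginal measure $\mu_{\mathcal X}:=\mathbf p_*\mu_\Theta$. Let $D_r(x)$ denote the open ball of radius $r$ in $\mathcal X$ centered at $x$. Let $S\subset\mathcal X$ be a measurable subset with $\mu_{\mathcal X}(S)=0$ and, for $k\in\mathbb N^+$, let $\mu_{\Theta|\mathcal X}(\cdot|\mathbf x)\in\mathcal P(\Theta)$, $\mathbf x\in\mathcal X^k$, be a family of posterior distributions of $\mu_\Theta$ after seeing data $\mathbf x$ such that $$\mu_{\Theta|\mathcal X}(B|\mathbf x)=\lim_{r\to0}\frac{\int_B\prod_{i=1}^k p_\theta(D_r(x_i))\,d\mu_\Theta}{\int_\Theta\prod_{i=1}^k p_\theta(D_r(x_i))\,d\mu_\Theta}$$ for every $B\in\mathcal B(\Theta)$ and every $\mathbf x=(x_1,\dots,x_k)\in(\mathcal X\setminus S)^k$. Then for any $\mathbf x=(x_1,\dots,x_k)\in(\mathcal X\setminus S)^k$ the set $S$ also has zero measure for the updated marginal measure $\mu_{\mathcal X}^{\mathbf x}:=\mathbf p_*\bigl(\mu_{\Theta|\mathcal X}(\cdot|\mathbf x)\bigr)$ with respect to the updated posterior measure $\mu_{\Theta|\mathcal X}(\cdot|\mathbf x)$, i.e. $\mu_{\mathcal X}^{\mathbf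 x}(S)=0$.
   Context: Topological spaces carry their Borel $\sigma$-algebra $\mathcal B(\cdot)$. A Souslin space is a Hausdorff space admitting a surjective continuous map from a complete separable metrizable space. For a measurable space $\mathcal X$, $\mathcal P(\mathcal X)$ is the set of probability measures on $\mathcal X$, with the $\sigma$-algebra $\Sigma_w$, the smallest one making $\mu\mapsto\mu(A)$ measurable for all measurable $A\subset\mathcal X$. A Bayesian statistical model is a quadruple $(\Theta,\mu_\Theta,\mathbf p,\mathcal X)$ where $\Theta,\mathcal X$ are measurable spaces, $\mathbf p:\Theta\to(\mathcal P(\mathcal X),\Sigma_w)$ is measurable and $\mu_\Theta\in\mathcal P(\Theta)$. For $\nu\in\mathcal P(\Theta)$, $(\mathbf p_*\nu)(A)=\int_\Theta\mathbf p(\theta)(A)\,d\nu(\theta)$. Posterior distributions: the joint distribution $\mu$ on $\Theta\times\mathcal X$ is determined by $\mu(B\times A)=\int_B\mathbf p(\theta)(A)\,d\mu_\Theta$. A family of probability measures $\mu_{\Theta|\mathcal X}(\cdot|x)\in\mathcal P(\Theta)$, $x\in\mathcal X$, is a family of posterior distributions if for every measurable $B\subset\Theta$, $\mu_{\Theta|\mathcal X}(B|x)=\frac{d(\Pi_{\mathcal X})_*(1_{B\times\mathcal X}\mu)}{d(\Pi_{\mathcal X})_*\mu}(x)$ in $L^1(\mathcal X,\mu_{\mathcal X})$, where $\Pi_{\mathcal X}:\Theta\times\mathcal X\to\mathcal X$ is the projection. For data $\mathbf x\in\mathcal X^k$, posterior distributions are those of the Bayesian statistical model $(\Theta,\mu_\Theta,\mathbf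 p^k,\mathcal X^k)$ with $\mathbf p^k(\theta)=p_\theta\otimes\dots\otimes p_\theta$ ($k$ factors). *)

(* Defs.v *)
From HB Require Import structures.
From mathcomp Require Import all_boot all_order all_algebra.
From mathcomp Require Import all_classical all_reals all_analysis.

Set Implicit Arguments.
Unset Strict Implicit.
Unset Printing Implicit Defensive.

Import Order.TTheory GRing.Theory Num.Theory.
Import numFieldNormedType.Exports.

Local Open Scope classical_set_scope.
Local Open Scope ring_scope.
Local Open Scope charge_scope.

(* Intended for U open: all iterated partial derivatives up to order k exist
   and are continuous on U. *)
Fixpoint Ck_on (R : realType) (n : nat) (W : normedModType R) (k : nat)
    (U : set 'rV[R]_n) (f : 'rV[R]_n -> W) : Prop :=
  (forall u, U u -> {for u, continuous f}) /\
  if k is k'.+1 then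
    forall i : 'I_n, (forall u, U u -> derivable f u (delta_mx ord0 i)) /\
      Ck_on k' U (fun u => 'D_(delta_mx ord0 i) f u)
  else True.

Definition smooth_on (R : realType) (n : nat) (W : normedModType R)
    (U : set 'rV[R]_n) (f : 'rV[R]_n -> W) : Prop :=
  forall k, Ck_on k U f.

(* A smooth n-manifold structure on M, given by an atlas that contains a
   distinguished chart around each point and is indexed by these points: the
   chart with index z has domain [chart_dom z], which contains z. Every smooth
   structure is generated by such an atlas (pick a chart around each point).
   The value of [chart z] outside of [chart_dom z], and that of its inverse
   [chartV z] outside of the open set [chart z @` chart_dom z], are junk. *)
Record smooth_structure (R : realType) (n : nat) (M : topologicalType) :=
  SmoothStructure {
  manifold_hausdorff : hausdorff_space M ;
  manifold_second_countable : @second_countable M ;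
  chart_dom : M -> set M ;
  chart : M -> M -> 'rV[R]_n ;
  chartV : M -> 'rV[R]_n -> M ;
  chart_dom_center : forall z, chart_dom z z ;
  chart_dom_open : forall z, open (chart_dom z) ;
  chart_codom_open : forall z, open (chart z @` chart_dom z) ;
  chartK : forall z x, chart_dom z x -> chartV z (chart z x) = x ;
  chart_continuous : forall z x, chart_dom z x ->
    {for x, continuous (chart z)} ;
  chartV_continuous : forall z x, chart_dom z x ->
    {for chart z x, continuous (chartV z)} ;
  chart_transition_smooth : forall z w,
    smooth_on (chart z @` (chart_dom z `&` chart_dom w))
      (chart w \o chartV z) }.

(* [gram z u] is the matrix, in the coordinates of the chart z, of the inner
   product on the tangent space at the point with coordinates u. *)
Record riemannian_metric (R : realType) (n : nat) (M : topologicalType)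
    (A : smooth_structure R n M) := RiemannianMetric {
  gram : M -> 'rV[R]_n -> 'M[R]_n ;
  gram_smooth : forall z, smooth_on (chart A z @` chart_dom A z) (gram z) ;
  gram_sym : forall z x, chart_dom A z x ->
    (gram z (chart A z x))^T = gram z (chart A z x) ;
  gram_posdef : forall z x (v : 'rV[R]_n), chart_dom A z x -> v != 0 ->
    0 < (v *m gram z (chart A z x) *m v^T) ord0 ord0 ;
  gram_transition : forall z w x (v v' : 'rV[R]_n),
    chart_dom A z x -> chart_dom A w x ->
    let tau := chart A w \o chartV A z in
    let u := chart A z x in
    v *m gram z u *m v'^T =
    'D_v tau u *m gram w (chart A w x) *m ('D_v' tau u)^T }.

Section riemannian_distance.
Context (R : realType) (n : nat) (M : topologicalType)
  (A : smooth_structure R n M).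

(* eta is a C^1 map into M on the open set V of times. *)
Definition C1_curve (V : set R) (eta : R -> M) : Prop :=
  [/\ open V, forall t, V t -> {for t, continuous eta} &
   forall z t, V t -> chart_dom A z (eta t) ->
     derivable (chart A z \o eta) t 1 /\
     {for t, continuous (fun s => 'D_1 (chart A z \o eta) s)}].

(* gamma is continuous on [0, 1] and C^1 (up to the endpoints, i.e. with a C^1
   extension to a neighborhood) on each closed piece of some subdivision
   0 = s_0 < ... < s_N = 1. *)
Definition piecewise_C1 (gamma : R -> M) : Prop :=
  {within `[0, 1], continuous gamma} /\
  exists (N : nat) (s : nat -> R), [/\ s 0%N = 0, s N = 1 &
    forall i, (i < N)%N -> s i < s i.+1 /\
      exists V eta, [/\ C1_curve V eta, `[s i, s i.+1] `<=` V &
        forall t, t \in `[s i, s i.+1] -> eta t = gamma t]].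

Context (g : riemannian_metric A).

(* The norm of the velocity, computed in the chart around gamma t. *)
Definition speed (gamma : R -> M) (t : R) : R :=
  let z := gamma t in
  let v := 'D_1 (chart A z \o gamma) t in
  Num.sqrt ((v *m gram g z (chart A z z) *m v^T) ord0 ord0).

Definition curve_length (gamma : R -> M) : \bar R :=
  (\int[lebesgue_measure]_(t in `[0%R, 1%R]) (speed gamma t)%:E)%E.

(* +oo if no curve joins x to y, which does not happen on connected M. *)
Definition rdist (x y : M) : \bar R :=
  ereal_inf [set curve_length gamma | gamma in
    [set gamma | [/\ piecewise_C1 gamma, gamma 0 = x & gamma 1 = y]]].

Definition riemannian_complete : Prop :=
  forall u : nat -> M,
    (forall e : R, 0 < e -> exists N, forall i j, (N <= i)%N -> (N <= j)%N ->
       (rdist (u i) (u j) < e%:E)%E) ->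
    exists x, forall e : R, 0 < e -> exists N, forall i, (N <= i)%N ->
      (rdist (u i) x < e%:E)%E.

End riemannian_distance.

(* Measurable types must be pointed, hence the nonemptiness proof. *)
Definition nonempty_subset (M : topologicalType) (X : set M)
  (X0 : X !=set0) : Type := set_type X.

Section nonempty_subset.
Context (M : topologicalType) (X : set M) (X0 : X !=set0).

Definition nonempty_subset_point : nonempty_subset X0 :=
  exist _ (sval (cid X0)) (mem_set (svalP (cid X0))).

HB.instance Definition _ := Choice.copy (nonempty_subset X0) (set_type X).
HB.instance Definition _ :=
  isPointed.Build (nonempty_subset X0) nonempty_subset_point.

End nonempty_subset.

Section induced_metric.
Context (R : realType) (n : nat) (M : topologicalType)
  (A : smooth_structure R n M) (g : riemannian_metric A)
  (X : set M) (X0 : X !=set0).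

Definition rball (r : R) (x : nonempty_subset X0) : set (nonempty_subset X0) :=
  [set y | (rdist g (\val x) (\val y) < r%:E)%E].

Definition ropen : set (set (nonempty_subset X0)) :=
  [set U | forall x, U x -> exists2 r : R, 0 < r & rball r x `<=` U].

(* X with the Borel sigma-algebra of the induced metric. *)
Definition metric_borel : measurableType ropen.-sigma :=
  g_sigma_algebraType ropen.

End induced_metric.

Definition borel (T : ptopologicalType) : measurableType (@open T).-sigma :=
  g_sigma_algebraType (@open T).

(* Complete separable metrizable = complete, separable, pseudometric and
   Hausdorff. *)
Definition souslin (R : realType) (T : topologicalType) : Prop :=
  hausdorff_space T /\
  exists (P : completePseudoMetricType R) (f : P -> T),
    [/\ hausdorff_space P, exists2 D : set P, countable D & dense D,
        continuous f & set_surj [set: P] [set: T] f].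

Section product_probability.
Context d1 d2 (T1 : measurableType d1) (T2 : measurableType d2) (R : realType)
  (P : probability T1 R) (Q : probability T2 R).

Let prod : set (T1 * T2) -> \bar R := (P \x Q)%E.

HB.instance Definition _ := Measure.on prod.

Let prod_setT : prod [set: T1 * T2] = 1%E.
Proof.
rewrite -setXTT /prod product_measure1E// -[RHS]mule1.
by congr (_ * _)%E; exact: probability_setT.
Qed.

HB.instance Definition _ := Measure_isProbability.Build _ _ _ prod prod_setT.

Definition product_probability : probability (T1 * T2)%type R := prod.

End product_probability.

Section power_probability.
Context d (T : measurableType d) (R : realType).

Let cons_tuple n (xt : T * n.-tuple T) : n.+1.-tuple T :=
  [the n.+1.-tuple T of xt.1 :: xt.2].

Let measurable_cons_tuple n : measurable_fun [set: T * n.-tuple T]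
  (@cons_tuple n).
Proof. exact: measurable_cons. Qed.

HB.instance Definition _ n :=
  @isMeasurableFun.Build _ _ _ _ (@cons_tuple n) (@measurable_cons_tuple n).

Definition cons_probability n (P : probability T R)
    (Q : probability (n.-tuple T) R) : probability (n.+1.-tuple T) R :=
  distribution (product_probability P Q) (@cons_tuple n).

Fixpoint power_probability (P : probability T R) (k : nat)
    : probability (k.-tuple T) R :=
  if k is k'.+1 then cons_probability P (power_probability P k')
  else dirac [tuple].

Lemma power_probabilityE (P : probability T R) k (A : 'I_k -> set T) :
  (forall i, measurable (A i)) ->
  power_probability P k [set x | forall i, A i (tnth x i)] =
  (\prod_(i < k) P (A i))%E.
Proof.
elim: k A => [|k IHk] A mA /=.
  rewrite big_ord0 /dirac/= indicE mem_set//= => -[]//.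
rewrite big_ord_recl -IHk//.
rewrite /cons_probability /distribution /pushforward/=.
rewrite -[RHS]product_measure1E//; last first.
  rewrite (_ : [set _ | _] = \big[setI/setT]_(i < k)
     ((fun x : k.-tuple T => tnth x i) @^-1` (A (lift ord0 i)))).
    apply: bigsetI_measurable => i _; rewrite -[X in measurable X]setTI.
    exact: (measurable_tnth i).
  apply/seteqP; split=> x.
    move=> Ax; apply: (big_ind (fun B : set (k.-tuple T) => B x)) => //.
    by move=> i _; exact: Ax.
  by move=> Ax i; move: Ax; rewrite (bigD1 i)//= => -[].
congr (_ _); apply/seteqP; split => -[x t]/=.
  move=> At; split; first by have := At ord0.
  by move=> i; have := At (lift ord0 i); rewrite tnthS.
move=> [Ax At] i; case: (unliftP ord0 i) => [j|] -> //.
by rewrite tnthS; exact: At.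
Qed.

End power_probability.

Section bayes.
Context d d' (Theta : measurableType d) (Y : measurableType d')
  (R : realType).

(* The marginal p_* nu of a model with parameter law nu. The sigma-algebra of
   the library's [pprobability Y R] is the one generated by the evaluations
   mu |-> mu A. *)
Definition marginal (p : Theta -> pprobability Y R) (nu : probability Theta R)
  (A : set Y) : \bar R := (\int[nu]_t (p t) A)%E.

Definition is_joint (mu : probability Theta R) (p : Theta -> pprobability Y R)
    (m : probability (Theta * Y)%type R) : Prop :=
  forall (B : set Theta) (A : set Y), measurable B -> measurable A ->
    m (B `*` A) = (\int[mu]_(t in B) (p t) A)%E.

HB.instance Definition _ :=
  @isMeasurableFun.Build _ _ _ _ (@snd Theta Y) measurable_snd.

Section slice.
Context (m : probability (Theta * Y)%type R) (B : set Theta)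
  (mB : measurable B).

(* The second projection of 1_(B * Y) m. *)
Definition slice : set Y -> \bar R :=
  pushforward (mrestr m (measurableX mB (@measurableT _ Y))) snd.

Let slice0 : slice set0 = 0%E.
Proof. by rewrite /slice /pushforward preimage_set0 measure0. Qed.

Let slice_ge0 C : (0 <= slice C)%E.
Proof. exact: measure_ge0. Qed.

Let slice_sigma_additive : semi_sigma_additive slice.
Proof.
by apply: measure_semi_sigma_additive => //; exact: measurable_snd.
Qed.

HB.instance Definition _ := isMeasure.Build _ _ _ slice
  slice0 slice_ge0 slice_sigma_additive.

Let slice_fin : fin_num_fun slice.
Proof.
move=> C mC; apply: fin_num_measure.
by rewrite -[X in measurable X]setTI; exact: measurable_snd.
Qed.

HB.instance Definition _ := Measure_isFinite.Build _ _ _ slice slice_fin.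

End slice.

(* post is only determined up to a null set of the marginal of m on Y. The
   densities are never junk: slice m mB is dominated by that marginal. *)
Definition is_posterior (mu : probability Theta R)
    (p : Theta -> pprobability Y R) (post : Y -> probability Theta R) : Prop :=
  exists2 m : probability (Theta * Y)%type R, is_joint mu p m &
    forall (B : set Theta) (mB : measurable B),
      ae_eq (distribution m snd) [set: Y] (fun y => post y B)
        ('d (charge_of_finite_measure (slice m mB)) '/d (distribution m snd)).

End bayes.

(* Main.v *)
Require Import Defs.
From mathcomp Require Import all_boot all_order all_algebra.
From mathcomp Require Import all_classical all_reals all_analysis.
From mathcomp Require Import measurable_realfun.
Import Order.TTheory GRing.Theory Num.Theory.
Import numFieldNormedType.Exports.
Local Open Scope classical_set_scope.
Local Open Scope ring_scope.

Import HBNNSimple.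

(** Let [B] be the set of parameters [t] with [p t S != 0]. Since [p t S] is nonnegative, its
    integral against a measure vanishes iff that measure does not charge [B] ([integral_eq0_null]).
    So [S_null] says [mu B = 0] and the goal says [post x B = 0]. The limit formula leads from one
    to the other: for every radius its numerator is an integral over the [mu]-null set [B], hence 0
    ([null_set_integral_nonmeasurable]). *)

(* Unlike in [null_set_integral], f need not be measurable. This makes the
   measurability of Riemannian balls irrelevant, and with it the triangle
   inequality for [rdist]. *)
Lemma null_set_integral_nonmeasurable {d} {T : measurableType d} {R : realType}
    (mu : {measure set T -> \bar R}) (N : set T) (f : T -> \bar R) :
  measurable N -> mu N = 0%E -> (\int[mu]_(t in N) f t = 0)%E.
Proof.
move=> mN muN0.
have ge0 (h : T -> \bar R) : (forall t, N t -> 0 <= h t)%E ->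
    (\int[mu]_(t in N) h t = 0)%E.
  move=> h0; apply/eqP; rewrite eq_le integral_ge0// andbT ge0_integralE//.
  apply/ge_ereal_sup => _ [s /= s_le <-].
  (* [s] lies below [h] extended by 0 off [N], so it takes positive values only inside [N] and each
     of these level sets is null. *)
  rewrite sintegralEnnsfun fsbig1// => r /= r0.
  rewrite (subset_measure0 (measurable_funPTI s (measurable_set1 r)) mN _ muN0).
    by rewrite mule0.
  move=> t /= str; have := s_le t; rewrite str patchE.
  by case: ifPn => [/set_mem//|_]; rewrite lee_fin leNgt r0.
by rewrite integralE !ge0 ?sube0.
Qed.

(** Used in both directions: for the prior [mu] to get a null set, for [post x] to return to the
    marginal. *)
Lemma integral_eq0_null {d} {T : measurableType d} {R : realType}
    (mu : {measure set T -> \bar R}) {f : T -> \bar R} :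
  measurable_fun [set: T] f -> (forall t, 0 <= f t)%E ->
  (\int[mu]_t f t = 0)%E <-> mu [set t | f t != 0%E] = 0%E.
Proof.
move=> mf f0; rewrite -negligibleP; last first.
  by rewrite -[X in measurable X]setTI; exact: emeasurable_neq.
have -> : [set t | f t != 0%E] = ~` [set t | setT t -> f t = cst 0%E t].
  apply/seteqP; split=> t /=; first by move=> /eqP f_neq0 /(_ I).
  by move=> f_neq0; apply/eqP => ft; exact: f_neq0.
apply: iff_trans (ae_eq_integral_abs mu measurableT mf).
by under [in X in _ <-> X]eq_integral do rewrite gee0_abs//.
Qed.

Theorem proposition14 (R : realType) (n : nat) (M : topologicalType)
    (A : smooth_structure R n M) (g : riemannian_metric A)
    (M_connected : connected [set: M]) (M_complete : riemannian_complete g)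
    (X : set M) (X0 : X !=set0)
    (Theta : ptopologicalType) (Theta_souslin : souslin R Theta)
    (mu : probability (borel Theta) R)
    (p : borel Theta -> pprobability (metric_borel g X0) R)
    (p_measurable : measurable_fun [set: borel Theta] p)
    (S : set (metric_borel g X0)) (S_measurable : measurable S)
    (S_null : marginal p mu S = 0%E)
    (k : nat) (k_gt0 : (0 < k)%N)
    (post : k.-tuple (metric_borel g X0) -> probability (borel Theta) R)
    (post_posterior :
      is_posterior mu (fun t => power_probability (p t) k) post)
    (post_limit : forall B : set (borel Theta), measurable B ->
      forall x : k.-tuple (metric_borel g X0), (forall i, ~ S (tnth x i)) ->
      (\int[mu]_(t in B) \prod_(i < k) fine (p t (rball g r (tnth x i)))) /
      (\int[mu]_(t in [set: borel Theta])
         \prod_(i < k) fine (p t (rball g r (tnth x i))))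
      @[r --> 0^'+] --> fine (post x B))
    (x : k.-tuple (metric_borel g X0)) (xS : forall i, ~ S (tnth x i)) :
  marginal p (post x) S = 0%E.
Proof.
have mpS : measurable_fun [set: borel Theta] (fun t => p t S).
  exact: (measurable_kernel (kprobability p_measurable)).
set B := [set t : borel Theta | p t S != 0%E].
have mB : measurable B.
  by rewrite -[B]setTI; exact: emeasurable_neq.
have muB : mu B = 0%E.
  by apply/(integral_eq0_null mu mpS).
have postB : post x B = 0%E.
  rewrite -[LHS]fineK ?fin_num_measure//; congr EFin.
  have := post_limit B mB x xS.
  (* The quotient is 0 for every [r], whatever the denominator, since inversion is total with
     [0^-1 = 0]. *)
  under eq_fun do rewrite /Rintegral null_set_integral_nonmeasurable// mul0r.
  by move=> /(cvg_unique (@Rhausdorff R)); apply; exact: cvg_cst.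
by apply/(integral_eq0_null (post x) mpS).
Qed.
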